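(* Let $n>1$ be a natural number that is not a power of $2$. Then there exists a non-regular lattice tiling of $\mathbb{R}^n$ by $n$-double-crosses.
   Context: Lee distance on $Z^n$: $\rho_L(v,w)=\sum_i|v_i-w_i|$; $S_{n,1}(v)=\{w:\rho_L(v,w)\le 1\}$; the double-sphere is $DS_{n,1}(v,w)=S_{n,1}(v)\cup S_{n,1}(w)$ for $\rho_L(v,w)=1$ (it has $4n$ points). The $n$-double-cross is the cluster of $4n$ unit cubes (cubes $c+[-\tfrac12,\tfrac12]^n$) centered at the points of a double-sphere $DS_{n,1}$. A lattice tiling of $\mathbb{R}^n$ by a cluster $C$ is a family $\{C+l;\ l\in\mathcal{L}\}$, $\mathcal{L}$ a lattice, of sets with disjoint interiors covering $\mathbb{R}^n$. Two unit cubes with centers $c,c'$ are neighbors if $|c_i-c_i'|=1$ for one index $i$ and $c_j=c_j'$ for $j\ne i$. The tiling is non-regular if two cubes from different tiles have an $(n-1)$-dimensional intersection but are not neighbors. *)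

(* Defs.v *)
From HB Require Import structures.
From mathcomp Require Import all_boot all_order all_algebra.
From mathcomp Require Import all_classical all_reals all_analysis.
Set Implicit Arguments. Unset Strict Implicit. Unset Printing Implicit Defensive.
Import Order.TTheory GRing.Theory Num.Theory.
Import numFieldNormedType.Exports.
Local Open Scope classical_set_scope.
Local Open Scope ring_scope.

Section DoubleCross.
Variables (R : realType) (n : nat).

Definition lee_dist (v w : 'rV[int]_n) : int := \sum_(i < n) `|v 0 i - w 0 i|.

Definition lee_ball1 (v : 'rV[int]_n) : set 'rV[int]_n :=
  [set w | lee_dist v w <= 1].
Definition double_sphere (v w : 'rV[int]_n) : set 'rV[int]_n :=
  lee_ball1 v `|` lee_ball1 w.

Definition to_real (z : 'rV[int]_n) : 'rV[R]_n := map_mx (fun k : int => k%:~R) z.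

Definition unit_cube (c : 'rV[R]_n) : set 'rV[R]_n :=
  [set x | forall i, `|x 0 i - c 0 i| <= 2^-1].

Definition double_cross (v w : 'rV[int]_n) : set 'rV[R]_n :=
  \bigcup_(c in double_sphere v w) unit_cube (to_real c).

Definition lattice_of (B : 'M[R]_n) : set 'rV[R]_n :=
  [set (to_real z) *m B | z in [set: 'rV[int]_n]].

Definition translate (S : set 'rV[R]_n) (l : 'rV[R]_n) : set 'rV[R]_n :=
  [set x + l | x in S].

Definition is_lattice_tiling (C : set 'rV[R]_n) (L : set 'rV[R]_n) : Prop :=
  (forall x : 'rV[R]_n, exists2 l, L l & translate C l x) /\
  (forall l l', L l -> L l' -> l <> l' ->
     (interior (translate C l)) `&` (interior (translate C l')) = set0).

Definition aff_dim_ge (S : set 'rV[R]_n) (k : nat) : Prop :=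
  exists (p0 : 'rV[R]_n) (P : 'M[R]_(k, n)),
    row_free P /\ S p0 /\ (forall i : 'I_k, S (p0 + row i P)).

Definition codim1 (S : set 'rV[R]_n) : Prop :=
  aff_dim_ge S n.-1 /\ ~ aff_dim_ge S n.

Definition neighbors (c c' : 'rV[R]_n) : Prop :=
  exists i : 'I_n, `|c 0 i - c' 0 i| = 1 /\
    (forall j : 'I_n, j != i -> c 0 j = c' 0 j).

Definition non_regular (v w : 'rV[int]_n) (L : set 'rV[R]_n) : Prop :=
  exists l l' (c c' : 'rV[int]_n),
    [/\ L l /\ L l', l <> l',
        double_sphere v w c, double_sphere v w c' &
        (codim1 (unit_cube (to_real c + l) `&` unit_cube (to_real c' + l')) /\
         ~ neighbors (to_real c + l) (to_real c' + l'))].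

End DoubleCross.

(* Main.v *)
(**
Let n >= 3 and label Z^n by a homomorphism onto Z/4 x Z/n sending e_0 to (1, 0)
and e_k to (s_k, k) for 0 < k < n, where s_k = 0, 1, 2 according to the sign of
2k - n, so that s_k + s_(n-k) = 2.  The labels of the double sphere around 0 and
e_0 exhaust the group: (-1, 0), (0, 0), (1, 0), (2, 0) come from the multiples of
e_0, and the four labels over k <> 0 are those of e_k, e_0 + e_k, - e_(n-k) and
e_0 - e_(n-k).  So the kernel L of the labelling gives a lattice tiling.

Since (1, 0) generates Z/4, the second component of the label is constant along
each line of cubes parallel to e_0.  Choose an odd function f on Z/n, let psi be
the linear form with psi(e_0) = 0 and psi(e_k) = f(k), and replace l in L by
l + psi(l) e_0.  The cube centred at x, which lies in the tile of x - d where d is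
the point of the double sphere with the label of x, moves by
(psi(x) - psi(d)) e_0, and psi(d) = f(k) where k is the second component of the
label of x.  This offset is constant along each line parallel to e_0, so every
such line slides rigidly and the tiling survives.  With f(1) = 1/4, f(-1) = -1/4
and f = 0 elsewhere, the cubes centred at e_1 and 2 e_1 slide by amounts whose
difference is not an integer.
*)
Require Import Defs.
From HB Require Import structures.
From mathcomp Require Import all_boot all_order all_algebra.
From mathcomp Require Import all_classical all_reals all_analysis.
From mathcomp Require Import zify ring lra.
Set Implicit Arguments.
Unset Strict Implicit.
Import Order.TTheory GRing.Theory Num.Theory.
Import numFieldNormedType.Exports.
Local Open Scope classical_set_scope.
Local Open Scope ring_scope.

(** * Integer linear forms and the points of a double sphere *)

Definition wsum (V : zmodType) (n : nat) (w : 'I_n -> V) (x : 'rV[int]_n) : V :=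
  \sum_(i < n) w i *~ x 0 i.

Lemma wsumD (V : zmodType) (n : nat) (w : 'I_n -> V) x y :
  wsum w (x + y) = wsum w x + wsum w y.
Proof. by rewrite -big_split; apply: eq_bigr => i _; rewrite mxE mulrzDr. Qed.

Lemma wsumB (V : zmodType) (n : nat) (w : 'I_n -> V) x y :
  wsum w (x - y) = wsum w x - wsum w y.
Proof. by rewrite -sumrB; apply: eq_bigr => i _; rewrite !mxE mulrzBr. Qed.

Lemma wsum_axis (V : zmodType) (n : nat) (w : 'I_n -> V) (a : int) k :
  wsum w (a *: delta_mx 0 k) = w k *~ a.
Proof.
rewrite /wsum (bigD1 k) //= !mxE !eqxx mulr1 big1 ?addr0 // => i ik.
by rewrite !mxE (negPf ik) andbF mulr0 mulr0z.
Qed.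

Lemma lee_ball1P (n : nat) (v w : 'rV[int]_n) : lee_ball1 v w <->
  w = v \/ exists k e, (e = 1 \/ e = -1) /\ w = v + e *: delta_mx 0 k.
Proof.
split; rewrite /lee_ball1 /lee_dist /=.
  move=> vw; have [->|wv] := eqVneq w v; first by left.
  have /existsP[k wvk] : [exists k, w 0 k != v 0 k].
    apply: contraNT wv => /existsPn h; apply/eqP/rowP => k.
    by apply/eqP; have := h k; rewrite negbK.
  right; exists k, (w 0 k - v 0 k).
  have others0 : (\sum_(i < n | i != k) `|v 0 i - w 0 i| = 0) /\
                 `|v 0 k - w 0 k| = 1.
    move: vw; rewrite (bigD1 k) //= => vw.
    have : 0 <= \sum_(i < n | i != k) `|v 0 i - w 0 i|.
      by apply: sumr_ge0 => i _; apply: normr_ge0.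
    move: wvk; move: vw; move: (\sum_(_ < _ | _) _) => S; lia.
  split; first by case: others0 => _; lia.
  apply/rowP => j; rewrite !mxE /=; have [->|jk] := eqVneq j k; first by lia.
  case: others0 => /psumr_eq0P h _; rewrite mulr0 addr0.
  by have := h (fun i _ => normr_ge0 _) j jk; lia.
case=> [->|[k [e [he ->]]]].
  by rewrite big1 // => i _; rewrite subrr normr0.
rewrite (bigD1 k) //= !mxE !eqxx big1 => [|i ik]; last first.
  by rewrite !mxE (negPf ik) andbF mulr0 addr0 subrr normr0.
by rewrite mulr1 opprD addNKr; lia.
Qed.

Lemma double_sphereP (n : nat) (d : 'rV[int]_n.+1) :
  double_sphere 0 (delta_mx 0 ord0) d <->
  (exists a : int, -1 <= a <= 2 /\ d = a *: delta_mx 0 ord0) \/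
  (exists a e k, [/\ k != ord0, a = 0 \/ a = 1, e = 1 \/ e = -1 &
     d = a *: delta_mx 0 ord0 + e *: delta_mx 0 k]).
Proof.
rewrite /double_sphere; split.
  have ball (c : int) : 0 <= c <= 1 ->
      lee_ball1 (c *: delta_mx 0 ord0) d ->
      (exists a : int, -1 <= a <= 2 /\ d = a *: delta_mx 0 ord0) \/
      (exists a e k, [/\ k != ord0, a = 0 \/ a = 1, e = 1 \/ e = -1 &
        d = a *: delta_mx 0 ord0 + e *: delta_mx 0 k]).
    move=> c01 /lee_ball1P[->|[k [e [he ->]]]].
      by left; exists c; split=> //; lia.
    have [->|k0] := eqVneq k ord0.
      by left; exists (c + e); rewrite scalerDl; split=> //; lia.
    by right; exists c, e, k; split=> //; lia.
  case=> h; first by apply: (ball 0) => //; rewrite scale0r.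
  by apply: (ball 1) => //; rewrite scale1r.
case=> [[a [ha ->]]|[a [e [k [_ ha he ->]]]]].
  have [->|[->|[->|->]]] : a = -1 \/ a = 0 \/ a = 1 \/ a = 2 by lia.
  - by left; apply/lee_ball1P; right; exists ord0, (-1); rewrite add0r; split=> //; right.
  - by left; apply/lee_ball1P; left; rewrite scale0r.
  - by right; apply/lee_ball1P; left; rewrite scale1r.
  - right; apply/lee_ball1P; right; exists ord0, 1; split; first by left.
    by rewrite -[2]/(1 + 1) scalerDl scale1r.
case: ha => ->; [left|right]; apply/lee_ball1P; right; exists k, e; split=> //.
  by rewrite scale0r.
by rewrite scale1r.
Qed.

(** * The labelling by Z/4 x Z/n and its bijectivity on the double sphere *)

Section Labelling.
Variable m : nat.
Notation n := (m.+3).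
Notation axis := (delta_mx 0 ord0).
Implicit Types (x d : 'rV[int]_n) (k : 'I_n).

Definition twist k : int :=
  if k == ord0 then 1
  else if (k.*2 < n)%N then 0 else if k.*2 == n then 1 else 2.

(** Labels stay integers; reduction modulo 4 and n happens only through divisibility in
    [label_ker]. *)
Definition label4 : 'rV[int]_n -> int := wsum twist.
Definition labeln : 'rV[int]_n -> int := wsum (fun i : 'I_n => i%:Z).

Definition label_ker x : Prop := (4 %| label4 x)%Z /\ (n%:Z %| labeln x)%Z.

Lemma twist0 : twist ord0 = 1.
Proof. by []. Qed.

Lemma twist_compl k k' : (k + k' = n)%N -> twist k + twist k' = 2.
Proof.
rewrite /twist -!val_eqE /=; case: k k' => [k hk] [k' hk'] /= h.
do ?case: ifP; lia.
Qed.

Lemma labels_cover x : exists2 d, double_sphere 0 axis d & label_ker (x - d).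
Proof.
pose r := absz (labeln x %% n%:Z)%Z.
have rE : r%:Z = (labeln x %% n%:Z)%Z by rewrite gez0_abs // modz_ge0.
have rn : (r < n)%N by rewrite -ltz_nat rE ltz_pmod.
have dvdr : (n%:Z %| labeln x - r%:Z)%Z by rewrite rE -eqz_mod_dvd modz_mod.
pose k : 'I_n := Ordinal rn.
have [r0|r0] := eqVneq r 0%N.
  (* The shift by 1 selects the representative modulo 4 in -1..2. *)
  pose a : int := ((label4 x + 1) %% 4)%Z - 1.
  exists (a *: axis); first by apply/double_sphereP; left; exists a; split=> //; lia.
  rewrite /label_ker /label4 /labeln !wsumB !wsum_axis /= mul0rz subr0 twist0 mulrzz.
  split; first by rewrite -/(label4 x) /a; lia.
  by move: dvdr; rewrite r0 subr0.
have k0 : k != ord0 by rewrite -val_eqE.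
(* The point [b] e_0 + e_k has the label of [x]; it lies in the double sphere when [b] is 0 or 1.
   Otherwise ([b] - 2) e_0 - e_(n-k) serves, its first label being [b] - 4 + [twist k]. *)
pose b : int := ((label4 x - twist k) %% 4)%Z.
have [b2|b2] := ltP b 2.
  exists (b *: axis + 1 *: delta_mx 0 k).
    by apply/double_sphereP; right; exists b, 1, k; split=> //; lia.
  rewrite /label_ker /label4 /labeln !wsumB !wsumD !wsum_axis /= mul0rz add0r.
  split; last by rewrite mulrzz mulr1.
  rewrite twist0 -/(label4 x) /b !mulrzz; lia.
have nrn : (n - r < n)%N by lia.
pose k' : 'I_n := Ordinal nrn.
have k'0 : k' != ord0 by rewrite -val_eqE /=; lia.
have tkk' : twist k + twist k' = 2 by apply: twist_compl => /=; lia.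
exists ((b - 2) *: axis + (-1) *: delta_mx 0 k').
  by apply/double_sphereP; right; exists (b - 2), (-1), k'; split=> //; rewrite /b; lia.
rewrite /label_ker /label4 /labeln !wsumB !wsumD !wsum_axis /= mul0rz add0r.
split.
  rewrite twist0 -/(label4 x) /b !mulrzz; lia.
rewrite -/(labeln x) mulrzz mulrN1 opprK -subzn; last exact: ltnW.
have -> : labeln x + (n%:Z - r%:Z) = (labeln x - r%:Z) + n%:Z by ring.
by rewrite rpredD ?dvdzz.
Qed.

Lemma dvdz_small (N : nat) (z : int) : (N%:Z %| z)%Z -> `|z| < N%:Z -> z = 0.
Proof.
rewrite dvdzE absz_nat => Nz zN; apply/eqP; rewrite -absz_eq0.
by apply: contraTT Nz => z0; rewrite gtnNdvd ?lt0n // -ltz_nat abszE.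
Qed.

Lemma labels_inj d d' : double_sphere 0 axis d -> double_sphere 0 axis d' ->
  label_ker (d - d') -> d = d'.
Proof.
move=> /double_sphereP[[a [ha ->]]|[a [e [k [k0 ha he ->]]]]]
       /double_sphereP[[a' [ha' ->]]|[a' [e' [k' [k'0 ha' he' ->]]]]];
  rewrite /label_ker /label4 /labeln !wsumB ?wsumD !wsum_axis /=
    !mul0rz ?add0r ?subr0 ?sub0r ?twist0 !mulrzz => -[h4 hn].
- by congr (_ *: _); lia.
- exfalso; move: k'0; rewrite -val_eqE /= => k'0; have := ltn_ord k'.
  have := @dvdz_small _ _ hn; lia.
- exfalso; move: k0; rewrite -val_eqE /= => k0; have := ltn_ord k.
  have := @dvdz_small _ _ hn; lia.
have kn := ltn_ord k; have k'n := ltn_ord k'.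
have [ee|ee] := eqVneq e e'.
  have kk : k = k'.
    apply: val_inj => /=; have := @dvdz_small _ _ hn; rewrite -ee.
    by case: he => ->; lia.
  by subst k' e'; congr (_ *: _ + _); lia.
(* With opposite signs, k + k' = n, so the first labels differ by a - a' + 2 or a - a' - 2, never a
   multiple of 4 as |a - a'| <= 1. *)
exfalso.
have kk : (k + k' = n)%N.
  have : (n%:Z %| k%:Z + k'%:Z - n%:Z)%Z.
    rewrite rpredB ?dvdzz //.
    case: (he) (he') ee hn => -> [] -> // _.
      by rewrite mulr1 mulrN1 opprK.
    by rewrite mulr1 mulrN1 -opprD rpredN addrC.
  move: k0 k'0; rewrite -!val_eqE /= => k0 k'0.
  by move/dvdz_small; lia.
by have := twist_compl kk; case: he he' ee h4 => -> [] -> //; lia.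
Qed.

End Labelling.

(** * The shear along e_0 and the displaced cubes *)

Section Shear.
Variables (R : realType) (m : nat).
Notation n := (m.+3).
Notation axis := (delta_mx 0 ord0).
Implicit Types (x d l : 'rV[int]_n) (y : 'rV[R]_n).

(** The odd function f on Z/n; n >= 3 keeps the residues 1 and n - 1 apart. *)
Definition slide (k : int) : R :=
  if (k %% n%:Z)%Z == 1 then 4^-1
  else if (k %% n%:Z)%Z == n%:Z - 1 then - 4^-1 else 0.

Lemma slide_mod k k' : (n%:Z %| k - k')%Z -> slide k = slide k'.
Proof. by rewrite -eqz_mod_dvd /slide => /eqP ->. Qed.

Lemma slide0 : slide 0 = 0.
Proof.
rewrite /slide mod0z; have -> : (0 == n%:Z - 1 :> int) = false by lia.
by [].
Qed.

Lemma slideN k : slide (- k) = - slide k.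
Proof.
have dvdr : (n%:Z %| k - (k %% n%:Z)%Z)%Z by rewrite -eqz_mod_dvd modz_mod.
have r_ge0 : 0 <= (k %% n%:Z)%Z by rewrite modz_ge0.
have r_lt : (k %% n%:Z)%Z < n%:Z by rewrite ltz_pmod.
move: (k %% n%:Z)%Z dvdr r_ge0 r_lt => r dvdr r_ge0 r_lt.
rewrite (slide_mod dvdr).
have [r0|r0] := eqVneq r 0.
  rewrite r0 slide0 oppr0 -[RHS]slide0; apply: slide_mod.
  by rewrite subr0 rpredN; move: dvdr; rewrite r0 subr0.
rewrite (@slide_mod (- k) (n%:Z - r)); last first.
  have -> : - k - (n%:Z - r) = - (k - r) - n%:Z by ring.
  by rewrite rpredB ?rpredN ?dvdzz.
rewrite /slide !modz_small; [|lia|lia].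
have -> : (n%:Z - r == 1) = (r == n%:Z - 1) by lia.
have -> : (n%:Z - r == n%:Z - 1) = (r == 1) by lia.
have [->|r1] := eqVneq r 1.
  by have -> : (1 == n%:Z - 1 :> int) = false by lia.
by case: ifP; rewrite ?opprK ?oppr0.
Qed.

Definition psi : 'rV[int]_n -> R := wsum (fun i : 'I_n => slide i%:Z).

(** Off the axis, [d] has at most one nonzero coordinate, equal to 1 or -1, so oddness of [slide]
    suffices. *)
Lemma psi_sphere d : double_sphere 0 axis d -> psi d = slide (labeln d).
Proof.
move=> /double_sphereP[[a [ha ->]]|[a [e [k [_ _ he ->]]]]];
  rewrite /psi /labeln ?wsumD !wsum_axis /= slide0 !mul0rz ?slide0 // !add0r.
by case: he => ->; rewrite ?mulr1z // !mulrN1z slideN.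
Qed.

Definition offset x : R := psi x - slide (labeln x).

(** Both linear forms have weight 0 on e_0. *)
Lemma offset_column x x' : (forall j, j != ord0 -> x 0 j = x' 0 j) ->
  offset x = offset x'.
Proof.
move=> xx'; rewrite /offset /psi /labeln /wsum; congr (_ - slide _);
  apply: eq_bigr => i _; have [->|/xx' ->//] := eqVneq i ord0.
  by rewrite /= slide0 !mul0rz.
by rewrite !mul0rz.
Qed.

(* [place x] is the centre, in the sheared tiling, of the cube that was centred
   at [x]; [shear x] is the image of the lattice point [x]. *)
Definition place x : 'rV[R]_n := to_real R x + offset x *: axis.
Definition shear x : 'rV[R]_n := to_real R x + psi x *: axis.

Lemma placeE x i :
  place x 0 i = (x 0 i)%:~R + (if i == ord0 then offset x else 0).
Proof. by rewrite !mxE eqxx /=; case: ifP => _; rewrite ?mulr1 ?mulr0. Qed.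

(** Since [d + l] and [d] agree in [labeln] modulo n, the offset of [d + l] is psi(d + l) - psi(d) =
    psi(l): the tile moves as a whole. *)
Lemma place_add d l : double_sphere 0 axis d -> label_ker l ->
  place (d + l) = to_real R d + shear l.
Proof.
move=> dS [_ hl]; rewrite /place /shear /offset.
have -> : slide (labeln (d + l)) = psi d.
  rewrite psi_sphere //; apply: slide_mod.
  by rewrite /labeln wsumD addrC addKr.
rewrite /psi wsumD addrAC subrr add0r; apply/rowP => i.
by rewrite !mxE intrD; ring.
Qed.

Lemma translate_crossP l y : label_ker l ->
  translate (@double_cross R n 0 axis) (shear l) y <->
  exists2 d, double_sphere 0 axis d & unit_cube (place (d + l)) y.
Proof.
move=> hl; split.
  move=> [x [d dS xd] <-]; exists d => // i.
  by rewrite place_add // !mxE opprD addrACA subrr addr0; have := xd i; rewrite mxE.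
move=> [d dS yd]; exists (y - shear l); last by rewrite subrK.
exists d => // i; have := yd i; rewrite place_add // => h.
by rewrite mxE; move: h; rewrite !mxE; congr (`|_| <= _); ring.
Qed.

Lemma nearest_place y : exists x, forall i,
  place x 0 i - 2^-1 <= y 0 i < place x 0 i + 2^-1.
Proof.
have nearest (r : R) : exists k : int, k%:~R - 2^-1 <= r < k%:~R + 2^-1.
  exists (Num.floor (r + 2^-1)).
  by have := Num.Theory.floor_itv (r + 2^-1); rewrite intrD; lra.
have [u hu] := choice (fun i => nearest (y 0 i)).
(* The coordinates off the axis already determine the offset; [u ord0] is only a placeholder in
   it. *)
have [u0 hu0] := nearest (y 0 ord0 - offset (\row_i u i)).
exists (\row_i if i == ord0 then u0 else u i) => i; rewrite placeE mxE.
rewrite (@offset_column _ (\row_i u i)); last first.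
  by move=> j j0; rewrite !mxE (negPf j0).
by case: eqVneq => [->|_]; [lra | have := hu i; lra].
Qed.

(** Off the axis the centres are integers less than 1 apart, hence equal. The offsets then agree,
    and the same argument applies along e_0. *)
Lemma place_inj x x' y : (forall i, `|y 0 i - place x 0 i| < 2^-1) ->
  unit_cube (place x') y -> x = x'.
Proof.
move=> yx yx'.
have close i : place x 0 i - (x 0 i)%:~R = place x' 0 i - (x' 0 i)%:~R ->
    x 0 i = x' 0 i.
  move=> eqs; suff : `|x 0 i - x' 0 i| < 1 by lia.
  rewrite -(ltr_int R) intr_norm intrB.
  move: eqs (yx i) (yx' i); rewrite !ltr_norml !ler_norml; lra.
have cols j : j != ord0 -> x 0 j = x' 0 j.
  by move=> j0; apply: close; rewrite !placeE (negPf j0); ring.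
apply/rowP => i; have [->|/cols//] := eqVneq i ord0.
by apply: close; rewrite !placeE eqxx (offset_column cols); ring.
Qed.

End Shear.

(** * A basis of the sheared lattice and the tiling property *)

Lemma wsum_mulmx (V : zmodType) (p q : nat) (w : 'I_q -> V) (z : 'rV[int]_p)
    (A : 'M[int]_(p, q)) :
  wsum w (z *m A) = \sum_i wsum w (row i A) *~ z 0 i.
Proof.
rewrite /wsum; under [RHS]eq_bigr do rewrite mulrz_suml.
rewrite exchange_big; apply: eq_bigr => j _.
rewrite mxE mulrz_sumr; apply: eq_bigr => i _.
by rewrite mxE mulrC mulrzA.
Qed.

Section Lattice.
Variables (R : realType) (m : nat).
Notation n := (m.+3).
Notation axis := (delta_mx 0 ord0).
Notation one := (lift ord0 ord0 : 'I_n).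
Notation cross := (@double_cross R n 0 axis).
Implicit Types (x d l : 'rV[int]_n) (y : 'rV[R]_n).

(** A triangular basis of the kernel: e_1 has label (0, 1), so e_i is corrected by multiples of e_1
    and e_0. The factor 1 lets [wsum_axis] apply. *)
Definition ker_basis : 'M[int]_n := \matrix_i
  (if i == ord0 then 4 *: axis else if i == one then n%:Z *: delta_mx 0 one
   else 1 *: delta_mx 0 i - i%:Z *: delta_mx 0 one - twist i *: axis).

Lemma val_one : (one : nat) = 1%N.
Proof. by []. Qed.

Lemma twist1 : twist one = 0.
Proof. by []. Qed.

Lemma label4_basis (z : 'rV[int]_n) : label4 (z *m ker_basis) = 4 * z 0 ord0.
Proof.
rewrite /label4 wsum_mulmx (bigD1 ord0) //= rowK eqxx wsum_axis twist0 big1.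
  by rewrite addr0 -mulrzA; lia.
move=> i i0; rewrite rowK (negPf i0); case: ifP => _.
  by rewrite wsum_axis twist1 !mul0rz.
by rewrite !wsumB !wsum_axis twist1 twist0 !mulrzz; lia.
Qed.

Lemma labeln_basis (z : 'rV[int]_n) : labeln (z *m ker_basis) = n%:Z * z 0 one.
Proof.
rewrite /labeln wsum_mulmx (bigD1 one) //= rowK eqxx wsum_axis big1.
  by rewrite addr0 !mulrzz val_one mul1r.
move=> i i1; rewrite rowK (negPf i1); case: ifP => [/eqP -> | _].
  by rewrite wsum_axis /= !mul0rz.
by rewrite !wsumB !wsum_axis val_one /= !mulrzz; lia.
Qed.

Lemma basis_coord (z : 'rV[int]_n) (j : 'I_n) : j != ord0 -> j != one ->
  (z *m ker_basis) 0 j = z 0 j.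
Proof.
move=> j0 j1; rewrite mxE (bigD1 j) //= mxE (negPf j0) (negPf j1) !mxE !eqxx.
rewrite (negPf j0) (negPf j1) big1 => [|i ij]; first by rewrite /=; lia.
rewrite mxE; case: ifP => [_|i0]; last case: ifP => [_|i1].
- by rewrite !mxE (negPf j0) /= !mulr0.
- by rewrite !mxE (negPf j1) /= !mulr0.
by rewrite !mxE (negPf j0) (negPf j1) eq_sym (negPf ij) /= !mulr0.
Qed.

Lemma label_kerP x : label_ker x <-> exists z : 'rV[int]_n, x = z *m ker_basis.
Proof.
split=> [[/dvdzP[q q4] /dvdzP[q' qn]]|[z ->]]; last first.
  by split; rewrite ?label4_basis ?labeln_basis dvdz_mulr.
pose z : 'rV[int]_n :=
  \row_i if i == ord0 then q else if i == one then q' else x 0 i.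
exists z; apply/eqP; rewrite -subr_eq0; set y := x - _.
(* The difference [y] is supported on e_0 and e_1, where the two integer labels read off the
   coordinates. *)
have y4 : label4 y = 0.
  by rewrite /label4 wsumB -!/(label4 _) label4_basis q4 mxE eqxx; lia.
have yn : labeln y = 0.
  by rewrite /labeln wsumB -!/(labeln _) labeln_basis qn mxE eqxx /=; lia.
have yE : y = y 0 ord0 *: axis + y 0 one *: delta_mx 0 one.
  apply/rowP => j; have [->|j0] := eqVneq j ord0; first by rewrite !mxE /=; lia.
  have [->|j1] := eqVneq j one; first by rewrite !mxE /=; lia.
  rewrite [RHS]mxE [in RHS]mxE [X in _ = _ + X]mxE ![delta_mx _ _ _ _]mxE.
  rewrite (negPf j0) (negPf j1) !mulr0 addr0 /y.
  by rewrite mxE [X in _ + X]mxE basis_coord // mxE (negPf j0) (negPf j1) subrr.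
move: yn y4; rewrite yE /label4 /labeln !wsumD !wsum_axis twist0 twist1 val_one.
rewrite !mul0rz add0r addr0 !mulrzz !mul1r => -> ->.
by rewrite !scale0r addr0.
Qed.

Definition shear_mx : 'M[R]_n :=
  1%:M + (\col_i slide R m (i : 'I_n)%:Z) *m delta_mx 0 ord0.

Lemma shear_mulmx x : shear R x = to_real R x *m shear_mx.
Proof.
rewrite mulmxDr mulmx1 mulmxA; congr (_ + _).
rewrite [_ *m \col__ _]mx11_scalar mul_scalar_mx; congr (_ *: _).
by rewrite mxE; apply: eq_bigr => i _; rewrite !mxE mulrC mulrzr.
Qed.

(** The matrix is lower triangular, with unit diagonal because [slide] vanishes at 0. *)
Lemma shear_unit : shear_mx \in unitmx.
Proof.
have trig : is_trig_mx shear_mx.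
  apply/is_trig_mxP => i j ij; rewrite !mxE big_ord1 !mxE.
  have -> : (i == j) = false by rewrite -val_eqE /=; lia.
  have -> : (j == ord0) = false by rewrite -val_eqE /=; lia.
  by rewrite andbF mulr0 addr0.
rewrite unitmxE det_trig // big1 ?unitr1 // => i _.
rewrite !mxE big_ord1 !mxE eqxx /=; have [->|_] := eqVneq i ord0.
  by rewrite slide0 mul0r addr0.
by rewrite mulr0 addr0.
Qed.

Lemma ker_basis_unit : map_mx (intr : int -> R) ker_basis \in unitmx.
Proof.
rewrite unitmxE det_map_mx det_trig.
  rewrite unitfE intr_eq0; apply/prodf_neq0 => i _; rewrite mxE.
  have [->|i0] := eqVneq i ord0; first by rewrite !mxE.
  have [->|i1] := eqVneq i one; first by rewrite !mxE eqxx mulr1.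
  by rewrite !mxE !eqxx (negPf i0) (negPf i1) /= !mulr0 !subr0.
apply/is_trig_mxP => i j ij; rewrite mxE.
have j0 : (j == ord0) = false by rewrite -val_eqE /=; lia.
have ji : (j == i) = false by rewrite -val_eqE /=; lia.
have [_|i0] := eqVneq i ord0; first by rewrite !mxE j0 mulr0.
have [i1|i1] := eqVneq i one; first by rewrite !mxE -i1 ji mulr0.
have j1 : (j == one) = false.
  by move: i0 i1 ij; rewrite -!val_eqE /= /bump /=; lia.
by rewrite !mxE j0 j1 ji !mulr0 subr0.
Qed.

Definition sheared_basis : 'M[R]_n := map_mx intr ker_basis *m shear_mx.

Lemma sheared_basis_unit : sheared_basis \in unitmx.
Proof. by rewrite unitmx_mul ker_basis_unit shear_unit. Qed.

Lemma lattice_ofP y : lattice_of sheared_basis y <->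
  exists2 l, label_ker l & y = shear R l.
Proof.
have zB (z : 'rV[int]_n) : to_real R z *m sheared_basis = shear R (z *m ker_basis).
  by rewrite shear_mulmx /to_real map_mxM mulmxA.
split=> [[z _ <-]|[l /label_kerP[z ->] ->]]; last by exists z.
by exists (z *m ker_basis) => //; apply/label_kerP; exists z.
Qed.

Lemma cube_generic (p : nat) (y c : 'rV[R]_p) :
    (forall i, c 0 i - 2^-1 <= y 0 i < c 0 i + 2^-1) ->
  \forall t \near (0 : R)^'+,
    forall i, `|(y + t *: const_mx 1) 0 i - c 0 i| < 2^-1.
Proof.
move=> yc; apply: filter_forall => i; near=> t.
have t0 : 0 < t by near: t; exact: nbhs_right_gt.
have tc : t < c 0 i + 2^-1 - y 0 i.
  by near: t; apply: nbhs_right_lt; have := yc i; lra.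
by rewrite !mxE ltr_norml; have := yc i; lra.
Unshelve. all: by end_near.
Qed.

Lemma sheared_tiling : is_lattice_tiling cross (lattice_of sheared_basis).
Proof.
split=> [y|? ? /lattice_ofP[l hl ->] /lattice_ofP[l' hl' ->] ll'].
  have [x hx] := nearest_place y.
  have [d dS xd] := labels_cover x.
  exists (shear R (x - d)); first by apply/lattice_ofP; exists (x - d).
  apply/translate_crossP => //; exists d => // i.
  have -> : d + (x - d) = x by rewrite addrC subrK.
  by rewrite ler_norml; have := hx i; lra.
apply/seteqP; split=> // y [yl yl'].
pose g (t : R) : 'rV[R]_n := y + t *: const_mx 1.
have g0 : g t @[t --> 0^'+] --> y.
  have -> : y = g 0 by rewrite /g scale0r addr0.
  apply: cvg_at_right_filter; apply: cvgD; first exact: cvg_cst.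
  apply: cvgZr_tmp; exact: cvg_id.
have [x hx] := nearest_place y.
(* The interior of a union of cubes may meet their faces; moving y slightly along
   (1, ..., 1) puts it in the interior of a single cube. *)
have both : \forall t \near (0 : R)^'+,
    (forall i, `|g t 0 i - place R x 0 i| < 2^-1) /\
    translate cross (shear R l) (g t) /\ translate cross (shear R l') (g t).
  apply: filterI; first exact: cube_generic.
  by apply: filterI; [apply: g0 yl | apply: g0 yl'].
have [t [tx [tl tl']]] := @filter_ex _ _ (at_right_proper_filter _) _ both.
move: tl tl' => /(translate_crossP _ hl)[d dS cd] /(translate_crossP _ hl')[d' dS' cd'].
(* Both sides are the index [x] of the one cube with [g t] in its interior; injectivity of labels
   then identifies the tiles. *)
have dl : d + l = d' + l' by rewrite -(place_inj tx cd) (place_inj tx cd').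
have dd' : d = d'.
  apply: labels_inj => //.
  have -> : d - d' = l' - l by rewrite -[d](addrK l) dl addrAC [d' + _]addrC addrK.
  case: hl hl' => h4 hn [h4' hn']; rewrite /label_ker /label4 /labeln !wsumB.
  by split; apply: rpredB.
by apply: ll'; congr (shear R _); apply: (addrI d); rewrite dl dd'.
Qed.
End Lattice.

(** * Two cubes sharing part of a facet without being neighbors *)

Section NonRegular.
Variables (R : realType) (m : nat).
Notation n := (m.+3).
Notation axis := (delta_mx 0 ord0).
Notation one := (lift ord0 ord0 : 'I_n).
Notation cross := (@double_cross R n 0 axis).

Lemma slide_one : slide R m 1 = 4^-1.
Proof. by rewrite /slide modz_small. Qed.

(** Here psi is 1/2, and [slide] at 2 is -1/4 for n = 3 and 0 otherwise. *)
Lemma offset_double : 2^-1 <= offset R (2 *: delta_mx 0 one : 'rV[int]_n) <= 3 / 4.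
Proof.
rewrite /offset /psi /labeln !wsum_axis val_one slide_one mulrzz mul1r.
rewrite /slide modz_small //=; case: ifP => _; rewrite -mulrzr; lra.
Qed.

Lemma shifted_facets (s : R) (p q : 'rV[R]_n) :
    2^-1 <= s <= 3 / 4 ->
    (forall i, p 0 i = (i == one)%:R) ->
    (forall i, q 0 i = if i == ord0 then s else (2 * (i == one))%:R) ->
  codim1 (unit_cube p `&` unit_cube q) /\ ~ neighbors p q.
Proof.
move=> s12 pE qE.
have one0 : (one == ord0) = false by [].
split; first split.
(* The intersection has x_1 = 3/2 and x_0 from s - 1/2 to 1/2. From x_0 = 1/2, steps of -1/4 along
   every axis but e_1 stay inside, as s <= 3/4. *)
- exists (2^-1 *: delta_mx 0 ord0 + (3 / 2) *: delta_mx 0 one).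
  exists (- (4^-1) *: row' one 1%:M); split; [|split].
  + apply/row_freeP; exists (- 4 *: (row' one 1%:M)^T).
    apply/matrixP => i j; rewrite !mxE (bigD1 (lift one i)) //= !mxE !eqxx.
    rewrite big1 => [|k ki].
      rewrite (inj_eq (@lift_inj _ _)) eq_sym addr0 mulr1.
      by rewrite mulrA mulrNN mulVf ?pnatr_eq0 ?mul1r.
    by rewrite !mxE eq_sym (negPf ki) mulr0 mul0r.
  + split=> i; rewrite ?pE ?qE !mxE /= ler_norml.
      have [->|i0] := eqVneq i ord0; first by rewrite /= mulr1n mulr0n; lra.
      by case: (i == one); rewrite /= ?mulr1n ?mulr0n; lra.
    have [->|i0] := eqVneq i ord0; first by rewrite /= mulr1n mulr0n; lra.
    by case: (i == one); rewrite /= ?mulr1n ?mulr0n; lra.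
  + move=> k.
    have row1 i : (lift one k == i)%:R = 0 :> R \/ (lift one k == i)%:R = 1 :> R.
      by case: (_ == _); [right|left].
    split=> i; rewrite ?pE ?qE !mxE /= ler_norml.
      have [->|i0] := eqVneq i ord0.
        by rewrite /= mulr1n mulr0n; have := row1 ord0; lra.
      have [->|i1] := eqVneq i one.
        by rewrite eq_sym (negPf (neq_lift _ _)) /= mulr1n mulr0n; lra.
      by rewrite /= mulr0n; have := row1 i; lra.
    have [->|i0] := eqVneq i ord0.
      by rewrite /= mulr1n mulr0n; have := row1 ord0; lra.
    have [->|i1] := eqVneq i one.
      by rewrite eq_sym (negPf (neq_lift _ _)) /= mulr1n mulr0n; lra.
    by rewrite /= mulr0n; have := row1 i; lra.
- move=> [p0 [P [Pfree [p0S PS]]]].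
  have facet x : (unit_cube p `&` unit_cube q) x -> x 0 one = 3 / 2.
    move=> [/(_ one) + /(_ one)]; rewrite pE qE eqxx one0 !ler_norml /=; lra.
  (* All points lie on x_1 = 3/2, so the square matrix [P] kills e_1 and cannot be invertible. *)
  have : P *m delta_mx one (0 : 'I_1) = 0.
    apply/matrixP => i j; rewrite mxE (bigD1 one) //= big1 => [|k k1].
      rewrite !mxE (ord1 j) !eqxx mulr1 addr0.
      by have := facet _ (PS i); rewrite !mxE (facet _ p0S); lra.
    by rewrite !mxE (negPf k1) mulr0.
  move/row_freeP: Pfree => [Q PQ] Pone.
  have /matrixP/(_ one 0) : delta_mx one (0 : 'I_1) = 0 :> 'cV[R]_n.
    by rewrite -[LHS]mul1mx -(mulmx1C PQ) -mulmxA Pone mulmx0.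
  by rewrite !mxE !eqxx => /eqP; rewrite oner_eq0.
(* The centres differ in both coordinates 0 and 1. *)
move=> [i [_ cj]].
have [i1|i1] := eqVneq i one.
  by have := cj ord0; rewrite i1 pE qE eqxx => /(_ isT) /=; lra.
have := cj one; rewrite eq_sym i1 pE qE eqxx one0 => /(_ isT) /=; lra.
Qed.

Lemma sheared_non_regular : non_regular 0 axis (lattice_of (sheared_basis R m)).
Proof.
have sE1 : double_sphere 0 axis (1 *: delta_mx 0 one : 'rV[int]_n).
  apply/double_sphereP; right; exists 0, 1, one; split=> //; try by left.
  by rewrite scale0r add0r.
set x := 2 *: delta_mx 0 one : 'rV[int]_n.
have [d dS xd] := labels_cover x.
have ker0 : label_ker (0 : 'rV[int]_n).
  by split; rewrite /label4 /labeln -(subrr x) wsumB subrr dvdz0.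
have px : to_real R d + shear R (x - d) = place R x.
  by rewrite -place_add // addrC subrK.
have p1 : to_real R (1 *: delta_mx 0 one : 'rV[int]_n) + shear R 0 =
    place R (1 *: delta_mx 0 one).
  by rewrite -place_add // addr0.
exists (shear R 0), (shear R (x - d)), (1 *: delta_mx 0 one), d; split=> //.
- by split; apply/lattice_ofP; [exists 0 | exists (x - d)].
(* If the tiles coincided, [d] would equal [place R x], whose coordinate along e_0 lies strictly
   between 0 and 1. *)
- move=> eq_shear.
  have shear0 : shear R (0 : 'rV[int]_n) = 0.
    apply/rowP => i; rewrite /shear /psi -(subrr x) wsumB !subrr scale0r.
    by rewrite !mxE addr0.
  have := px; rewrite -eq_shear shear0 addr0 => /matrixP/(_ 0 ord0).
  rewrite placeE eqxx !mxE /= => dE.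
  have := offset_double; rewrite -/x => ox.
  have : 0 < d 0 ord0 < 1 by rewrite -!(ltr_int R) dE; lra.
  by lia.
rewrite px p1; apply: (shifted_facets offset_double) => i; rewrite placeE.
  (* The cube at e_1 has offset 0, since e_1 belongs to the double sphere. *)
  rewrite /offset psi_sphere // subrr if_same addr0 !mxE /=.
  by case: eqP.
rewrite !mxE /=; have [->|i0] := eqVneq i ord0; first by rewrite /= add0r.
by case: eqP; rewrite addr0.
Qed.

End NonRegular.

Theorem theorem7 (R : realType) (n : nat) :
  (1 < n)%N -> ~ (exists k : nat, n = (2 ^ k)%N) ->
  exists (v w : 'rV[int]_n) (B : 'M[R]_n),
    [/\ lee_dist v w = 1, B \in unitmx,
        is_lattice_tiling (@double_cross R n v w) (lattice_of B) &
        non_regular v w (lattice_of B)].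
Proof.
case: n => [|[|[|m]]] // _ not_pow2.
  by case: not_pow2; exists 1%N.
exists 0, (delta_mx 0 ord0), (sheared_basis R m); split.
- rewrite /lee_dist (bigD1 ord0) //= big1 => [|i i0]; first by rewrite !mxE.
  by rewrite !mxE (negPf i0).
- exact: sheared_basis_unit.
- exact: sheared_tiling.
- exact: sheared_non_regular.
Qed.
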